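(* Suppose $\alpha\in\mathbb{N}_0^N$ and $\ell(\alpha)=m$ (with $1\leq m\leq N$). Then $$\mathcal{D}_m\zeta_\alpha=\left((N+1-r(\alpha,m))\kappa+\alpha_m\right)\theta_m^{-1}\zeta_{\widetilde{\alpha}},$$ where $\theta_m=(1,2)(2,3)\cdots(m-1,m)\in S_N$ and $\widetilde{\alpha}=\theta_m(\alpha-\varepsilon(m))=(\alpha_m-1,\alpha_1,\ldots,\alpha_{m-1},0,\ldots,0)$.
   Context: $\kappa$ is a formal parameter (transcendental over $\mathbb{Q}$); polynomials in $x=(x_1,\ldots,x_N)$ have coefficients in $\mathbb{Q}(\kappa)$. For $w\in S_N$, $(xw)_i=x_{w(i)}$, $wf(x)=f(xw)$, and for $\alpha\in\mathbb{N}_0^N$, $(w\alpha)_i=\alpha_{w^{-1}(i)}$; $(i,j)$ denotes a transposition. $\theta_1$ is the identity. $\varepsilon(i)$ is the $i$-th standard basis vector; $\ell(\alpha)=\max\{j:\alpha_j>0\}$. Dunkl operators: $\mathcal{D}_i f(x)=\frac{\partial}{\partial x_i}f(x)+\kappa\sum_{j\neq i}\frac{f(x)-(i,j)f(x)}{x_i-x_j}$. Set $\mathcal{U}_i f=\mathcal{D}_i(x_i f)-\kappa\sum_{j=1}^{i-1}(j,i)f$, $1\leq i\leq N$. $|\alpha|=\sum\alpha_i$, and $\alpha^+$ is the nonincreasing rearrangement of $\alpha$. $\alpha\succ\beta$ means $\alpha\neq\beta$ and $\sum_{i=1}^j\alpha_i\geq\sum_{i=1}^j\beta_i$ for $1\leq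 j\leq N$; $\alpha\vartriangleright\beta$ means $|\alpha|=|\beta|$ and either $\alpha^+\succ\beta^+$, or $\alpha^+=\beta^+$ and $\alpha\succ\beta$. $r(\alpha,i)=\#\{j:\alpha_j>\alpha_i\}+\#\{j:1\leq j\leq i,\alpha_j=\alpha_i\}$ and $\xi_i(\alpha)=(N-r(\alpha,i))\kappa+\alpha_i+1$. The $p$-basis $\{p_\alpha:\alpha\in\mathbb{N}_0^N\}$ is defined by $\sum_\alpha p_\alpha(x)y^\alpha=\prod_{i=1}^N\left((1-x_iy_i)^{-1}\prod_{j=1}^N(1-x_iy_j)^{-\kappa}\right)$. The $p$-monic nonsymmetric Jack polynomial $\zeta_\alpha$ is the unique polynomial $\zeta_\alpha=p_\alpha+\sum_{\beta\vartriangleright\alpha}A_{\beta\alpha}p_\beta$, $A_{\beta\alpha}\in\mathbb{Q}(\kappa)$, with $\mathcal{U}_i\zeta_\alpha=\xi_i(\alpha)\zeta_\alpha$ for $1\leq i\leq N$ (it is known that $A_{\beta\alpha}\neq0$ implies $\ell(\beta)\leq\ell(\alpha)$). *)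

(* Defs.v *)
From mathcomp Require Import all_boot all_order all_fingroup all_algebra.
From mathcomp Require Import mpoly.

Set Implicit Arguments.
Unset Strict Implicit.
Unset Printing Implicit Defensive.

Import GRing.Theory.
Local Open Scope ring_scope.

(* The field Q(kappa). *)
Definition Qkappa : fieldType := {fraction {poly rat}}.
Definition kappa : Qkappa := FracField.tofrac ('X : {poly rat}).

(* Coordinates are numbered from 0: the ordinal i : 'I_N is the index i + 1 of
   the usual 1-based convention, and x_(i + 1) is the variable 'X_i.
   [msym w f] is (w f)(x) = f(x w) with (x w)_i = x_(w i), because it
   substitutes 'X_(w i) for 'X_i. *)

Lemma swap_divides (N : nat) (i j : 'I_N) (f : {mpoly Qkappa[N]}) :
  exists g : {mpoly Qkappa[N]},
    f - msym (tperm i j) f == ('X_i - 'X_j) * g.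
Proof.
have closedM (p q : {mpoly Qkappa[N]}) :
    (exists g : {mpoly Qkappa[N]}, p - msym (tperm i j) p == ('X_i - 'X_j) * g) ->
    (exists g : {mpoly Qkappa[N]}, q - msym (tperm i j) q == ('X_i - 'X_j) * g) ->
    exists g : {mpoly Qkappa[N]}, p * q - msym (tperm i j) (p * q) == ('X_i - 'X_j) * g.
  move=> [g /eqP gP] [h /eqP hP].
  exists (g * q + msym (tperm i j) p * h).
  rewrite mulrDr [_ * (g * q)]mulrA -gP [_ * (_ * h)]mulrCA -hP msymM.
  by rewrite mulrBl mulrBr addrA subrK.
elim/mpolyind: f => [|c m p _ _ [g /eqP gP]].
  by exists 0; rewrite msym0 subrr mulr0.
have [h /eqP hP] : exists g : {mpoly Qkappa[N]},
    'X_[m] - msym (tperm i j) 'X_[m] == ('X_i - 'X_j) * g.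
  rewrite mpolyXE_id; elim/big_rec: _ => [|k p' _ IH].
    by exists 0; rewrite msym1 subrr mulr0.
  apply: (closedM) IH; elim: (m k) => [|e IHe].
    by exists 0; rewrite expr0 msym1 subrr mulr0.
  rewrite exprS; apply: (closedM) IHe; rewrite /msym mmapX mmap1U.
  case: tpermP => [->|->|_ _].
  - by exists 1; rewrite mulr1.
  - by exists (-1); rewrite mulrN1 opprB.
  - by exists 0; rewrite subrr mulr0.
exists (c *: h + g).
by rewrite msymD msymZ opprD addrACA -scalerBr hP gP mulrDr scalerAr.
Qed.

(* The polynomial (f - (i,j) f) / (x_i - x_j), meaningful for i != j. *)
Definition divdiff (N : nat) (i j : 'I_N) (f : {mpoly Qkappa[N]}) :
    {mpoly Qkappa[N]} :=
  xchoose (swap_divides i j f).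

Definition dunkl (N : nat) (i : 'I_N) (f : {mpoly Qkappa[N]}) :
    {mpoly Qkappa[N]} :=
  f^`M(i) + kappa *: \sum_(j < N | j != i) divdiff i j f.

Definition Uop (N : nat) (i : 'I_N) (f : {mpoly Qkappa[N]}) :
    {mpoly Qkappa[N]} :=
  dunkl i ('X_i * f) - kappa *: \sum_(j < N | (j < i)%N) msym (tperm j i) f.

Definition mnm_sorted (N : nat) (a : 'X_{1..N}) : 'X_{1..N} :=
  [multinom of sort geq a].

Definition mnm_dom (N : nat) (a b : 'X_{1..N}) : bool :=
  (a != b) &&
  [forall j : 'I_N,
     (\sum_(i < N | (i <= j)%N) b i <= \sum_(i < N | (i <= j)%N) a i)%N].

Definition mnm_tri (N : nat) (a b : 'X_{1..N}) : bool :=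
  (mdeg a == mdeg b) &&
  (mnm_dom (mnm_sorted a) (mnm_sorted b)
   || (mnm_sorted a == mnm_sorted b) && mnm_dom a b).

Definition rnk (N : nat) (a : 'X_{1..N}) (i : 'I_N) : nat :=
  (#|[set j : 'I_N | a i < a j]|
   + #|[set j : 'I_N | (j <= i) && (a j == a i)]|)%N.

Definition xi (N : nat) (a : 'X_{1..N}) (i : 'I_N) : Qkappa :=
  (N%:R - (rnk a i)%:R) * kappa + (a i)%:R + 1.

(* The 1-based position of the last nonzero entry, 0 for the zero composition. *)
Definition mnm_len (N : nat) (a : 'X_{1..N}) : nat :=
  (\max_(j < N | 0 < a j) j.+1)%N.

Definition mnm_act (N : nat) (w : 'S_N) (a : 'X_{1..N}) : 'X_{1..N} :=
  [multinom a ((w^-1)%g i) | i < N].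

Definition ord_prev (N : nat) (i : 'I_N) : 'I_N :=
  Ordinal (leq_ltn_trans (leq_pred i) (ltn_ord i)).

(* MathComp multiplies permutations from left to right; [perm_comp u v] is the
   product u v acting as i |-> u (v i). *)
Definition perm_comp (N : nat) (u v : 'S_N) : 'S_N := (v * u)%g.

(* theta_(m + 1) = (1,2)(2,3)...(m,m + 1); for m = 0 it is the identity. *)
Definition theta (N : nat) (m : 'I_N) : 'S_N :=
  \big[@perm_comp N/1%g]_(i < N | (0 < i <= m)%N) tperm (ord_prev i) i.

(* Formal power series in y_1, ..., y_N with coefficients in Q(kappa)[x]:
   [s a] is the coefficient of y^a. *)
Definition fps (N : nat) : Type := 'X_{1..N} -> {mpoly Qkappa[N]}.

Definition fps_one (N : nat) : fps N := fun a => (a == 0%MM)%:R.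

Definition fps_mul (N : nat) (s t : fps N) : fps N := fun a =>
  \sum_(b : 'X_{1..N < (mdeg a).+1} | (b <= a)%MM) s b * t (a - b)%MM.

(* The binomial series
     (1 - x_i y_j)^(-c) = \sum_n c (c + 1) ... (c + n - 1) / n! (x_i y_j)^n;
   for c = 1 it is the geometric series. *)
Definition binser (N : nat) (c : Qkappa) (i j : 'I_N) : fps N := fun a =>
  if a == (U_(j) *+ a j)%MM then
    ((\prod_(k < a j) (c + k%:R)) / ((a j)`!)%:R) *: 'X_i ^+ a j
  else 0.

Definition pgen (N : nat) : fps N :=
  \big[@fps_mul N/@fps_one N]_(i < N)
    fps_mul (binser 1 i i)
            (\big[@fps_mul N/@fps_one N]_(j < N) binser kappa i j).

Definition pbasis (N : nat) (a : 'X_{1..N}) : {mpoly Qkappa[N]} := @pgen N a.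

(* The conditions characterising zeta_a. As b |> a forces |b| = |a|, the sum
   over all b |> a is a sum over exponents of degree at most |a|. *)
Definition is_pJack (N : nat) (a : 'X_{1..N}) (f : {mpoly Qkappa[N]}) : Prop :=
  (exists A : 'X_{1..N} -> Qkappa,
     f = pbasis a
         + \sum_(b : 'X_{1..N < (mdeg a).+1} | mnm_tri b a) A b *: pbasis b)
  /\ (forall i : 'I_N, Uop i f = xi a i *: f).

Definition mnm_tilde (N : nat) (m : 'I_N) (a : 'X_{1..N}) : 'X_{1..N} :=
  mnm_act (theta m) (a - U_(m))%MM.

(* Main.v *)
(* The generating function G of the p-basis satisfies
     D_i G = y_i (D_i x_i + kappa) G,
   so D_i p_a is 0 if a_i = 0 and (D_i x_i + kappa) p_(a - e_i) otherwise. Let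
   Theta = theta_m D_m. On the subspace W of polynomials that are killed by D_j
   and invariant under (j,k) for all j, k > m, which is stable under all the
   U_i, Theta intertwines U_i with U_theta(i) (up to a shift by 1 for i = m),
   and Theta p_alpha = (U_1 + kappa) p_alpha~.

   By triangularity p_alpha is zeta_alpha plus multiples of zeta_b with
   b |> alpha, and likewise for p_alpha~. Since p_alpha is in W and the zeta_b
   have pairwise different spectra, all the terms of the expansion of p_alpha
   are in W, so Theta maps them to joint eigenvectors, and only the image of
   zeta_alpha has the spectrum of zeta_alpha~. Comparing the components with
   this spectrum gives
     Theta zeta_alpha = (xi_1(alpha~) + kappa) zeta_alpha~. *)

Require Import Defs.
From HB Require Import structures.
From mathcomp Require Import all_boot all_order all_fingroup all_algebra.
From mathcomp Require Import mpoly.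
From mathcomp Require Import boolp ring zify.

Set Implicit Arguments.
Unset Strict Implicit.
Unset Printing Implicit Defensive.

Import GRing.Theory.
Local Open Scope ring_scope.

(** * Symmetric group action and partial derivatives on polynomials *)

Lemma subm_self (n : nat) (m : 'X_{1..n}) : (m - m)%MM = 0%MM.
Proof. by apply/mnmP => i; rewrite mnmBE subnn mnm0E. Qed.

Lemma msym_var (N : nat) (K : fieldType) (w : 'S_N) (i : 'I_N) :
  msym w ('X_i : {mpoly K[N]}) = 'X_(w i).
Proof. by rewrite /msym mmapX mmap1U. Qed.

(** Reduces an identity between linear operators to its value at 1 and its behaviour under
    multiplication by a variable. *)
Lemma mpoly_ind_mulX (N : nat) (R : nzRingType) (Q : {mpoly R[N]} -> Prop) :
  (forall (c : R) p q, Q p -> Q q -> Q (c *: p + q)) -> Q 0 -> Q 1 ->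
  (forall i p, Q p -> Q ('X_i * p)) -> forall p, Q p.
Proof.
move=> QL Q0 Q1 QX; elim/mpolyind => [//|c m p _ _ Qp]; apply: QL => // {c p Qp}.
rewrite mpolyXE_id; elim/big_rec: _ => // i p _.
by elim: (m i) => [|e IHe] Qp; rewrite ?expr0 ?mul1r // exprS -mulrA; apply/QX/IHe.
Qed.

Lemma mderiv_msym (N : nat) (K : fieldType) (w : 'S_N) (i : 'I_N) (f : {mpoly K[N]}) :
  msym w f^`M(i) = (msym w f)^`M(w i).
Proof.
elim/mpoly_ind_mulX: f => [c p q IHp IHq|||j p IHp].
- by rewrite !linearP /= IHp IHq.
- by rewrite !raddf0.
- by rewrite msym1 -!(@mpolyC1 _ K) !mderivC msym0.
- rewrite msymM !mderivM msymD !msymM IHp msym_var !mderivX; congr (_ * _ + _).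
  rewrite !mnm1E (inj_eq perm_inj) msymZ.
  case: eqVneq => [->|_]; last by rewrite !scale0r.
  by rewrite !subm_self !mpolyX0 msym1.
Qed.

(** * Dunkl operators *)

Section Dunkl.

Variables (N : nat) (K : fieldType) (kappa : K).
Local Notation P := {mpoly K[N]}.
Variable divdiff : 'I_N -> 'I_N -> P -> P.
Hypothesis divdiffP : forall i j f,
  ('X_i - 'X_j) * divdiff i j f = f - msym (tperm i j) f.
Implicit Types (i j k : 'I_N) (f g : P) (w : 'S_N).

Lemma mpoly_scalerAr (c : K) f g : f * (c *: g) = c *: (f * g).
Proof. exact/esym/scalerAr. Qed.

Lemma mpoly_var_sub_neq0 i j : i != j -> 'X_i - 'X_j != 0 :> P.
Proof.
move=> ij; apply/eqP => /(congr1 (fun p : P => p@_(U_(i))%MM)) /eqP.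
rewrite mcoeffB !mcoeffX mcoeff0 eqxx; case: (eqVneq U_(j)%MM) => [/mnmP/(_ j)|_].
  by rewrite !mnm1E eqxx (negPf ij).
by rewrite subr0 (negPf (oner_neq0 _)).
Qed.

(** Cancellation of x_i - x_j in an integral domain; the rules for [divdiff] below are checked after
    this multiplication. *)
Lemma divdiff_uniq i j f g : i != j ->
  ('X_i - 'X_j) * g = f - msym (tperm i j) f -> divdiff i j f = g.
Proof.
by move=> ij fg; apply: (mulfI (mpoly_var_sub_neq0 ij)); rewrite fg divdiffP.
Qed.

Lemma divdiff_linear i j (c : K) f g : i != j ->
  divdiff i j (c *: f + g) = c *: divdiff i j f + divdiff i j g.
Proof.
move=> ij; apply: divdiff_uniq => //.
by rewrite mulrDr mpoly_scalerAr !divdiffP msymD msymZ opprD addrACA scalerBr.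
Qed.

Lemma divdiff_msym w i j f : i != j ->
  msym w (divdiff i j f) = divdiff (w i) (w j) (msym w f).
Proof.
move=> ij; apply/esym/divdiff_uniq; first by rewrite (inj_eq perm_inj).
have := congr1 (msym w) (divdiffP i j f).
rewrite msymM !msymB !msym_var => ->; congr (_ - _).
by rewrite -!msymMm -tpermJ conjgE mulKVg.
Qed.

Lemma divdiff_mulX i j k f : i != j ->
  divdiff i j ('X_k * f) = 'X_k * divdiff i j f
    + (k == i)%:R * msym (tperm i j) f - (k == j)%:R * msym (tperm i j) f.
Proof.
move=> ij; apply: divdiff_uniq => //.
rewrite mulrBr mulrDr mulrCA divdiffP msymM msym_var.
have [ki|ki] := eqVneq k i.
  by rewrite ki tpermL (negPf ij) !(mul1r, mul0r, mulr0, subr0); ring.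
have [kj|kj] := eqVneq k j.
  by rewrite kj tpermR !(mul1r, mul0r, mulr0); ring.
rewrite tpermD 1?eq_sym // !(mul0r, mulr0); ring.
Qed.

Definition dunkl_of i f : P := f^`M(i) + kappa *: \sum_(j < N | j != i) divdiff i j f.

Lemma dunkl_is_linear i : linear (dunkl_of i).
Proof.
move=> c f g; rewrite /dunkl_of linearP /= scalerDr addrACA.
rewrite scalerA mulrC -scalerA -!scalerDr.
congr (_ + _ *: _); rewrite scaler_sumr -big_split /=; apply: eq_bigr => j ji.
by rewrite divdiff_linear // eq_sym.
Qed.

Definition dunkl_linear i : {linear P -> P} := HB.pack (dunkl_of i)
  (GRing.isLinear.Build K P P _ (dunkl_of i) (dunkl_is_linear i)).

Lemma dunkl1 i : dunkl_of i (1 : P) = 0.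
Proof.
rewrite /dunkl_of -(@mpolyC1 _ K) mderivC add0r big1 ?scaler0 // => j ji.
by apply: divdiff_uniq; rewrite 1?eq_sym // mulr0 mpolyC1 msym1 subrr.
Qed.

(** Among the divided differences only the one for j = k does not commute with x_k. *)
Lemma dunkl_mulX i k f : k != i ->
  dunkl_of i ('X_k * f) = 'X_k * dunkl_of i f - kappa *: msym (tperm i k) f.
Proof.
move=> ki; rewrite /dunkl_of mderivM mderivX mnm1E (negPf ki).
rewrite scale0r mul0r add0r mulrDr.
rewrite -addrA; congr (_ + _); rewrite mpoly_scalerAr -scalerBr; congr (_ *: _).
have ik : i != k by rewrite eq_sym.
rewrite mulr_sumr (bigD1 k) //= [in RHS](bigD1 k) //= divdiff_mulX //.
rewrite eqxx (negPf ki) mul1r mul0r addr0 -!addrA.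
congr (_ + _); rewrite addrC; congr (_ + _).
apply: eq_bigr => j /andP[ji jk]; rewrite divdiff_mulX; last by rewrite eq_sym.
by rewrite (negPf ki) [k == j]eq_sym (negPf jk) !mul0r subr0 addr0.
Qed.

Lemma dunkl_mulXi i f :
  dunkl_of i ('X_i * f)
    = 'X_i * dunkl_of i f + f + kappa *: \sum_(j < N | j != i) msym (tperm i j) f.
Proof.
rewrite /dunkl_of mderivM mderivX mnm1E eqxx scale1r subm_self mpolyX0 mul1r.
rewrite (_ : \sum_(j < N | j != i) divdiff i j ('X_i * f)
    = 'X_i * (\sum_(j < N | j != i) divdiff i j f)
      + \sum_(j < N | j != i) msym (tperm i j) f).
  by rewrite mulrDr mpoly_scalerAr scalerDr [f + _]addrC addrACA !addrA.
rewrite mulr_sumr -big_split /=; apply: eq_bigr => j ji.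
rewrite divdiff_mulX; last by rewrite eq_sym.
by rewrite eqxx [i == j]eq_sym (negPf ji) mul1r mul0r subr0.
Qed.

Lemma dunkl_msym w i f : msym w (dunkl_of i f) = dunkl_of (w i) (msym w f).
Proof.
rewrite /dunkl_of msymD msymZ mderiv_msym (raddf_sum (msym w)) /=; congr (_ + _ *: _).
rewrite [RHS](reindex_inj (@perm_inj _ w)) /=.
apply: eq_big => j; first by rewrite (inj_eq perm_inj).
by move=> ji; rewrite divdiff_msym // eq_sym.
Qed.

End Dunkl.

(** * Commutativity of the Dunkl operators from their relations with variables and permutations *)

Section DunklAlgebra.

Variables (N : nat) (K : fieldType) (kappa : K).
Local Notation P := {mpoly K[N]}.
Variable D : 'I_N -> {linear P -> P}.
Hypothesis D1 : forall i, D i 1 = 0.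
Hypothesis D_mulX : forall i k f, k != i ->
  D i ('X_k * f) = 'X_k * D i f - kappa *: msym (tperm i k) f.
Hypothesis D_mulXi : forall i f,
  D i ('X_i * f)
    = 'X_i * D i f + f + kappa *: \sum_(j < N | j != i) msym (tperm i j) f.
Hypothesis D_msym : forall w i f, msym w (D i f) = D (w i) (msym w f).

Implicit Types (i j k : 'I_N) (f g : P) (w : 'S_N).

Let DD i f g : D i (f + g) = D i f + D i g. Proof. exact: raddfD. Qed.
Let DN i f : D i (- f) = - D i f. Proof. exact: raddfN. Qed.
Let DZ i c f : D i (c *: f) = c *: D i f. Proof. exact: linearZ_LR. Qed.

(* The commutator of the two operators commutes with multiplication by every
   variable and vanishes at 1. *)
Lemma D_comm i j f : D i (D j f) = D j (D i f).
Proof.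
have [->//|ij] := eqVneq i j.
(* Here the variable is one of the two indices; naming it b serves both k = j and, with the sides
   exchanged, k = i. *)
have step (a b : 'I_N) (p : P) : a != b -> D a (D b p) = D b (D a p) ->
    D a (D b ('X_b * p)) = D b (D a ('X_b * p)).
  move=> ab abp; have ba : b != a by rewrite eq_sym.
  have Da : D a (msym (tperm b a) p) = msym (tperm b a) (D b p).
    by rewrite D_msym tpermL.
  have Db : D b (msym (tperm b a) p) = msym (tperm b a) (D a p).
    by rewrite D_msym tpermR.
  have Dl : D a (\sum_(l < N | (l != b) && (l != a)) msym (tperm b l) p)
      = \sum_(l < N | (l != b) && (l != a)) msym (tperm b l) (D a p).
    rewrite (raddf_sum (D a)) /=; apply: eq_bigr => l /andP[lb la].
    by rewrite D_msym tpermD // eq_sym.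
  rewrite D_mulXi D_mulX // !DD DN !DZ D_mulX // D_mulXi abp.
  rewrite (bigD1 a) //= [in RHS](bigD1 a) //= DD Dl [tperm a b]tpermC Da Db.
  rewrite !scalerDr; ring.
elim/mpoly_ind_mulX: f => [c p q IHp IHq|||k p IHp].
- by rewrite !linearP /= IHp IHq.
- by rewrite !raddf0.
- by rewrite !D1 !raddf0.
have [->|ki] := eqVneq k i; first by rewrite [RHS]step // eq_sym.
have [->|kj] := eqVneq k j; first exact: step.
(* For k outside {i, j} both sides have the same corrections with (i,k) and (j,k), since each D
   moves past the transposition that fixes its index. *)
have Dk (l l' : 'I_N) : k != l -> l' != l ->
    D l (msym (tperm l' k) p) = msym (tperm l' k) (D l p).
  by move=> kl ll'; rewrite D_msym tpermD.
have ji : j != i by rewrite eq_sym.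
rewrite (D_mulX _ kj) (D_mulX _ ki) !DD !DN !DZ (D_mulX _ ki) (D_mulX _ kj) IHp.
by rewrite (Dk i j) // -(Dk j i) // addrAC.
Qed.

End DunklAlgebra.

(** * Formal power series *)

Definition series (n : nat) (R : comNzRingType) : Type := 'X_{1..n} -> R.

HB.instance Definition _ (n : nat) (R : comNzRingType) :=
  gen_eqMixin (series n R).
HB.instance Definition _ (n : nat) (R : comNzRingType) :=
  gen_choiceMixin (series n R).

Section SeriesRing.

Variables (n : nat) (R : comNzRingType).
Implicit Types (s t u : series n R) (a : 'X_{1..n}).

Definition sadd s t : series n R := fun a => s a + t a.
Definition sopp s : series n R := fun a => - s a.
(* Convertible to [fps_mul], which makes [pgen] a product in this ring. *)
Definition smul s t : series n R := fun a =>
  \sum_(b : 'X_{1..n < (mdeg a).+1} | (b <= a)%MM) s b * t (a - b)%MM.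
Definition sone : series n R := fun a => (a == 0%MM)%:R.

Definition trunc (d : nat) s : {mpoly R[n]} :=
  \sum_(b : 'X_{1..n < d.+1}) s b *: 'X_[b].

Lemma mcoeff_trunc d s a : (mdeg a <= d)%N -> (trunc d s)@_a = s a.
Proof. by move=> ad; rewrite mcoeff_mpoly. Qed.

(** Coefficients of a product up to degree d depend only on those of the factors up to degree d.
    Beyond d the polynomials [p] and [q] are arbitrary, so that a product of truncations can serve
    as a factor in [smulA]. *)
Lemma mcoeffM_trunc d (p q : {mpoly R[n]}) s t a : (mdeg a <= d)%N ->
    (forall b, (mdeg b <= d)%N -> p@_b = s b) ->
    (forall b, (mdeg b <= d)%N -> q@_b = t b) ->
  (p * q)@_a = smul s t a.
Proof.
move=> ad ps qt; rewrite [LHS](@mcoeff_poly_mul_lin _ _ p q a (mdeg a).+1) //.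
apply: eq_bigr => b _; rewrite ps; last by rewrite -ltnS (leq_trans (bmdeg b)).
by rewrite qt //; apply: leq_trans (mdegB _ _) ad.
Qed.

Lemma smulE s t a d : (mdeg a <= d)%N ->
  smul s t a = (trunc d s * trunc d t)@_a.
Proof.
by move=> ad; rewrite (@mcoeffM_trunc d _ _ s t) // => b; apply: mcoeff_trunc.
Qed.

Fact saddA : associative sadd.
Proof. by move=> s t u; apply/funext => a; rewrite /sadd addrA. Qed.
Fact saddC : commutative sadd.
Proof. by move=> s t; apply/funext => a; rewrite /sadd addrC. Qed.
Fact sadd0 : left_id (fun=> 0) sadd.
Proof. by move=> s; apply/funext => a; rewrite /sadd add0r. Qed.
Fact saddN : left_inverse (fun=> 0) sopp sadd.
Proof. by move=> s; apply/funext => a; rewrite /sadd addNr. Qed.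

HB.instance Definition _ :=
  GRing.isZmodule.Build (series n R) saddA saddC sadd0 saddN.

Fact smulC : commutative smul.
Proof.
by move=> s t; apply/funext => a; rewrite !(smulE _ _ (leqnn _)) mulrC.
Qed.
Fact smulA : associative smul.
Proof.
move=> s t u; apply/funext => a.
set d := mdeg a; rewrite -(@mcoeffM_trunc d (trunc d s) (trunc d t * trunc d u)) //.
- rewrite mulrA; apply: (@mcoeffM_trunc d) => // b ?.
    exact/esym/smulE.
  by rewrite mcoeff_trunc.
- by move=> b ?; rewrite mcoeff_trunc.
- by move=> b ?; apply/esym/smulE.
Qed.
Fact smul1 : left_id sone smul.
Proof.
move=> s; apply/funext => a.
rewrite -(@mcoeffM_trunc (mdeg a) 1 (trunc (mdeg a) s)) //.
- by rewrite mul1r mcoeff_trunc.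
- by move=> b _; rewrite mcoeff1.
- by move=> b ?; rewrite mcoeff_trunc.
Qed.
Fact smulD : left_distributive smul sadd.
Proof.
move=> s t u; apply/funext => a; rewrite /smul /sadd -big_split /=.
by apply: eq_bigr => b _; rewrite mulrDl.
Qed.
Fact sone_neq0 : sone != (fun=> 0).
Proof.
by apply/eqP => /(congr1 (fun s => s 0%MM)) /eqP; rewrite /sone eqxx oner_eq0.
Qed.

HB.instance Definition _ := GRing.Zmodule_isComNzRing.Build (series n R)
  smulA smulC smul1 smulD sone_neq0.

Lemma seriesD s t a : (s + t) a = s a + t a. Proof. by []. Qed.
Lemma seriesN s a : (- s) a = - s a. Proof. by []. Qed.
Lemma series1 a : (1 : series n R) a = (a == 0%MM)%:R. Proof. by []. Qed.
Lemma seriesM s t a : (s * t) a =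
  \sum_(b : 'X_{1..n < (mdeg a).+1} | (b <= a)%MM) s b * t (a - b)%MM.
Proof. by []. Qed.
Lemma series_sum (I : Type) (r : seq I) (Q : pred I) (F : I -> series n R) a :
  (\sum_(i <- r | Q i) F i) a = \sum_(i <- r | Q i) F i a.
Proof. by elim/big_rec2: _ => // i x y _ <-. Qed.

Definition mono (m : 'X_{1..n}) (c : R) : series n R :=
  fun a => if a == m then c else 0.

Lemma mono_mul m c s a :
  (mono m c * s) a = if (m <= a)%MM then c * s (a - m)%MM else 0.
Proof.
rewrite seriesM; case: ifPn => [ma|]; last first.
  move=> nma; rewrite big1 // => b ba; rewrite /mono ifN ?mul0r //.
  by apply: contraNneq nma => <-.
have md : (mdeg m < (mdeg a).+1)%N.
  by rewrite ltnS -(submK ma) mdegD leq_addl.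
rewrite (bigD1 (BMultinom md)) //= big1 ?addr0 /mono ?eqxx // => b /andP[_ bm].
by rewrite ifN ?mul0r.
Qed.

Lemma mono0_mul c s a : (mono 0%MM c * s) a = c * s a.
Proof. by rewrite mono_mul subm0 ifT //; apply/mnm_lepP => k; rewrite mnm0E. Qed.

Lemma monoM m c m' c' : mono m c * mono m' c' = mono (m + m')%MM (c * c').
Proof.
apply/funext => a; rewrite mono_mul /mono.
case: ifPn => [ma|]; last first.
  by move=> nma; case: eqP => // am; case/negP: nma; rewrite am lem_addr.
rewrite -{2}(submK ma) addmC eqm_add2l; by case: ifP => //; rewrite mulr0.
Qed.

End SeriesRing.

Section SeriesMaps.

Variables (n : nat) (R : comNzRingType).
Implicit Types (s t u : series n R) (a : 'X_{1..n}).

Definition smap (f : R -> R) s : series n R := fun a => f (s a).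

Lemma smapM (f : {rmorphism R -> R}) s t : smap f (s * t) = smap f s * smap f t.
Proof.
apply/funext => a.
by rewrite /smap !seriesM rmorph_sum; apply: eq_bigr => b _; rewrite rmorphM.
Qed.

Lemma smap_prod (f : {rmorphism R -> R}) (I : Type) (r : seq I)
    (F : I -> series n R) :
  smap f (\prod_(i <- r) F i) = \prod_(i <- r) smap f (F i).
Proof.
apply: (big_morph (smap f)) => [s t|]; first exact: smapM.
by apply/funext => a; rewrite /smap !series1 rmorph_nat.
Qed.

(** Substitutes y_(w^-1 j) for y_j, as [binser_sperm] shows on a single factor. *)
Definition sperm (w : 'S_n) s : series n R := fun a => s (mnm_act w a).

Lemma mnm_actE w a k : mnm_act w a k = a ((w^-1)%g k).
Proof. exact: mnmE. Qed.

Lemma mdeg_act w a : mdeg (mnm_act w a) = mdeg a.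
Proof. exact: mdeg_mperm. Qed.

Lemma spermM w s t : sperm w (s * t) = sperm w s * sperm w t.
Proof.
apply/funext => a; set d := mdeg a.
(* On truncations, [msym] of w^-1 relabels the coefficients in the same way, so its multiplicativity
   carries over. *)
transitivity ((msym (w^-1)%g (trunc d s * trunc d t))@_a).
  by rewrite mcoeff_sym -smulE // mdeg_act.
rewrite msymM; apply: (@mcoeffM_trunc _ _ d) => // b bd.
  by rewrite mcoeff_sym mcoeff_trunc // mdeg_act.
by rewrite mcoeff_sym mcoeff_trunc // mdeg_act.
Qed.

Lemma sperm_prod w (I : Type) (r : seq I) (F : I -> series n R) :
  sperm w (\prod_(i <- r) F i) = \prod_(i <- r) sperm w (F i).
Proof.
apply: (big_morph (sperm w)) => [s t|]; first exact: spermM.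
apply/funext => a; rewrite /sperm !series1; congr (_%:R).
by rewrite -!mdeg_eq0 mdeg_act.
Qed.

End SeriesMaps.

Lemma prod_log_derivation (A : comNzRingType) (d : A -> A) (I : Type) (r : seq I)
    (F u : I -> A) : (forall x y, d (x * y) = d x * y + x * d y) ->
    (forall i, d (F i) = u i * F i) ->
  d (\prod_(i <- r) F i) = (\sum_(i <- r) u i) * \prod_(i <- r) F i.
Proof.
move=> dM dF; elim: r => [|i r IHr].
  (* The empty product needs d 1 = 0, which follows from d (1 * 1) = d 1 + d 1. *)
  rewrite !big_nil mul0r; have := dM 1 1; rewrite !mulr1 mul1r => /eqP.
  by rewrite -subr_eq subrr eq_sym => /eqP.
by rewrite !big_cons dM dF IHr; ring.
Qed.

(** * Dunkl operators on the p-basis *)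

Section BinomialSeries.

Variable N : nat.
Local Notation P := {mpoly Qkappa[N]}.
Local Notation S := (series N P).
Implicit Types (i j k : 'I_N) (c : Qkappa) (a : 'X_{1..N}).

Lemma Qkappa_nat_neq0 (e : nat) : (e.+1%:R : Qkappa) != 0.
Proof.
have -> : (e.+1%:R : Qkappa) = FracField.tofrac (e.+1%:R : {poly rat}).
  exact/esym/(rmorph_nat (@FracField.tofrac {poly rat})).
by rewrite tofrac_eq0 -polyC_natr polyC_eq0 Num.Theory.pnatr_eq0.
Qed.

Definition bcoef c (e : nat) : Qkappa := (\prod_(l < e) (c + l%:R)) / (e`!)%:R.

Lemma bcoef0 c : bcoef c 0 = 1.
Proof. by rewrite /bcoef big_ord0 fact0 divr1. Qed.

(** The differential equation (1 - z) F' = c F of F = (1 - z)^(-c), read off on coefficients. *)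
Lemma bcoefS c e : e.+1%:R * bcoef c e.+1 = (c + e%:R) * bcoef c e.
Proof.
have aux (K : fieldType) (s A x f : K) : s != 0 -> f != 0 ->
    s * ((A * x) / (s * f)) = x * (A / f).
  by move=> s0 f0; field; rewrite s0 f0.
rewrite /bcoef big_ord_recr /= factS natrM aux ?Qkappa_nat_neq0 //.
by rewrite -(prednK (fact_gt0 e)) Qkappa_nat_neq0.
Qed.

Lemma bcoef1 e : bcoef 1 e = 1.
Proof.
elim: e => [|e IHe]; first exact: bcoef0.
by apply: (mulfI (Qkappa_nat_neq0 e)); rewrite bcoefS IHe -nat1r.
Qed.

Lemma binserE c i j a :
  binser c i j a = if a == (U_(j) *+ a j)%MM then bcoef c (a j) *: 'X_i ^+ a j else 0.
Proof. by []. Qed.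

Lemma submU_line a j : (U_(j) <= a)%MM ->
  (a - U_(j) == U_(j) *+ (a - U_(j))%MM j)%MM = (a == U_(j) *+ a j)%MM.
Proof.
move=> ja; rewrite -[in RHS](submK ja) mnmDE mnm1E eqxx addn1 mulmSr.
by rewrite eqm_add2r.
Qed.

Lemma binser_line_sub c i j a : a j != 0%N ->
  binser c i j (a - U_(j))%MM =
    if a == (U_(j) *+ a j)%MM then bcoef c (a j).-1 *: 'X_i ^+ (a j).-1 else 0.
Proof.
move=> aj; rewrite binserE submU_line; last by rewrite lep1mP.
by rewrite mnmBE mnm1E eqxx subn1.
Qed.

Lemma binser_geom i j : (1 - mono U_(j)%MM 'X_i) * (binser 1 i j : S) = 1.
Proof.
apply/funext => a; rewrite mulrBl mul1r seriesD seriesN mono_mul series1 lep1mP.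
case: eqP => [a0|/eqP aj] /=.
  by rewrite subr0 binserE a0 bcoef1 scale1r mulm0n; case: eqP.
rewrite binser_line_sub // binserE !bcoef1 !scale1r.
have -> : a == 0%MM = false.
  by apply: contraNF aj => /eqP ->; rewrite mnm0E.
case: ifP => _; last by rewrite mulr0 subrr.
by rewrite -exprS prednK ?lt0n // subrr.
Qed.

Lemma mderiv_var_expn i (e : nat) : ('X_i ^+ e.+1 : P)^`M(i) = e.+1%:R *: 'X_i ^+ e.
Proof.
by rewrite !mpolyXn mderivX mulmnE mnm1E eqxx mul1n mulmS addmC addmK.
Qed.

(** The same equation for z = x_i y_j, free of denominators: multiplication by y_j shifts exponents,
    so coefficients can be compared directly. *)
Lemma binser_mderiv_sub c i j :
  (1 - mono U_(j)%MM 'X_i) * smap (mderiv i) (binser c i j : S)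
    = mono U_(j)%MM c%:MP * (binser c i j : S).
Proof.
apply/funext => a; rewrite mulrBl mul1r seriesD seriesN !mono_mul lep1mP /smap.
case: eqP => [a0|/eqP aj] /=.
  rewrite subr0 binserE a0 bcoef0 expr0; case: ifP => _; last by rewrite mderiv0.
  by rewrite mderivZ -(@mpolyC1 N Qkappa) mderivC scaler0.
rewrite binser_line_sub // binserE; case: ifP => _; last first.
  by rewrite mderiv0 !mulr0 subrr.
have [e ->] : exists e, a j = e.+1 by exists (a j).-1; rewrite prednK ?lt0n.
rewrite !mderivZ mderiv_var_expn /= scalerA.
have -> : 'X_i * (bcoef c e *: ('X_i ^+ e)^`M(i))
    = (e%:R * bcoef c e) *: ('X_i ^+ e : P).
  case: e => [|e].
    rewrite expr0 -(@mpolyC1 N Qkappa) mderivC.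
    by rewrite scaler0 mulr0 mul0r scale0r.
  by rewrite mderiv_var_expn exprS scalerA -scalerAr [_ * bcoef _ _]mulrC.
by rewrite mul_mpolyC scalerA -scalerBl mulrC bcoefS mulrDl addrK.
Qed.

Lemma binser_mderiv c i j :
  smap (mderiv i) (binser c i j : S) =
     mono U_(j)%MM c%:MP * (binser 1 i j : S) * (binser c i j : S).
Proof.
rewrite -[LHS]mul1r -(binser_geom i j) [(1 - _) * _]mulrC -[LHS]mulrA.
by rewrite binser_mderiv_sub; ring.
Qed.

End BinomialSeries.

(** * The generating product in an abstract commutative ring *)

Section CauchyProduct.

Variables (A : comNzRingType) (N : nat) (K : A) (x y : 'I_N -> A).
(* [e i j] and [E i j] stand for the powers of 1 - x_i y_j with exponents -1
   and -K, and [G] for the generating function of the p-basis. *)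
Variables (e E : 'I_N -> 'I_N -> A).
Hypothesis e_geom : forall i j, (1 - x i * y j) * e i j = 1.
Implicit Types i j k : 'I_N.

Let G := \prod_(i < N) (e i i * \prod_(j < N) E i j).

Lemma cauchy_derivation (d : A -> A) i :
    (forall s t, d (s * t) = d s * t + s * d t) ->
    (forall k j, d (e k j) = if k == i then y j * e k j * e k j else 0) ->
    (forall k j, d (E k j) = if k == i then K * y j * e k j * E k j else 0) ->
  d G = (y i * e i i + K * \sum_(j < N) y j * e i j) * G.
Proof.
move=> dM de dE.
pose u k := if k == i then y i * e i i + K * \sum_(j < N) y j * e i j else 0.
rewrite /G (@prod_log_derivation _ d _ _ _ u) //.
  by rewrite (bigD1 i) //= big1 ?addr0 /u ?eqxx // => k /negPf ->.
move=> k; rewrite dM (@prod_log_derivation _ d _ _ _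
  (fun j => if k == i then K * (y j * e i j) else 0)) //.
  rewrite /u de; have [->|ki] := eqVneq k i; last first.
    by rewrite /= big1_eq !mul0r mulr0 addr0.
  by rewrite /= mulr_sumr; ring.
by move=> j; rewrite dE; case: eqP => [->|_]; rewrite ?mul0r // !mulrA.
Qed.

(** Swapping rows i and j leaves the double product of the [E] unchanged and only turns the diagonal
    factors e_ii, e_jj into e_ji, e_ij. *)
Let Gt i j := \prod_(k < N) (e (tperm i j k) k * \prod_(l < N) E (tperm i j k) l).

Lemma cauchy_tperm i j : i != j ->
  Gt i j = e i j * e j i * (1 - x i * y i) * (1 - x j * y j) * G.
Proof.
move=> ij; have ji : j != i by rewrite eq_sym.
pose H := \prod_(k < N | (k != i) && (k != j)) e k k
  * \prod_(k < N) \prod_(l < N) E k l.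
have GH : G = e i i * (e j j * H).
  by rewrite /G big_split /= (bigD1 i) //= (bigD1 j) //= /H; ring.
have -> : Gt i j = e j i * (e i j * H).
  rewrite /Gt big_split /= [X in _ * X](_ : _ = \prod_(k < N) \prod_(l < N) E k l).
    rewrite (bigD1 i) //= (bigD1 j) //= tpermL tpermR.
    rewrite (eq_bigr (fun k => e k k)) => [|k /andP[ki kj]].
      by rewrite /H; ring.
    by rewrite tpermD // eq_sym.
  by rewrite [RHS](reindex_inj (@perm_inj _ (tperm i j))).
rewrite GH.
transitivity (e j i * (e i j * H) * ((1 - x i * y i) * e i i)
  * ((1 - x j * y j) * e j j)); first by rewrite !e_geom !mulr1.
by ring.
Qed.

(** Rests on (1 - x_i y_j)(1 - x_j y_i) - (1 - x_i y_i)(1 - x_j y_j) = (x_i - x_j)(y_i - y_j). *)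
Lemma cauchy_divdiff i j : i != j ->
  (x i - x j) * ((y i - y j) * e i j * e j i * G) = G - Gt i j.
Proof.
move=> ij; rewrite cauchy_tperm //.
transitivity (((1 - x i * y j) * e i j) * ((1 - x j * y i) * e j i) * G
   - e i j * e j i * (1 - x i * y i) * (1 - x j * y j) * G); first by ring.
by rewrite !e_geom !mul1r.
Qed.

(** This is D_i G = y_i (D_i x_i + K) G, with D_i x_i expanded and x_i y_i D_i G moved to the
    left. *)
Lemma cauchy_dunkl i :
  (1 - x i * y i) * ((y i * e i i + K * \sum_(j < N) y j * e i j) * G
      + K * \sum_(j < N | j != i) (y i - y j) * e i j * e j i * G)
    = y i * (G + K * G + K * \sum_(j < N | j != i) Gt i j).
Proof.
(* The j-th terms of the derivative and of the difference part combine by y_j (1 - x_j y_i) + y_i -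
   y_j = y_i (1 - x_j y_j). *)
have step j : j != i ->
    (1 - x i * y i) * (y j * e i j * G + (y i - y j) * e i j * e j i * G)
    = y i * Gt i j.
  move=> ji; rewrite cauchy_tperm 1?eq_sym //.
  transitivity ((1 - x i * y i) * e i j
    * (y j * ((1 - x j * y i) * e j i) + (y i - y j) * e j i) * G); last by ring.
  by rewrite e_geom; ring.
rewrite [in LHS](bigD1 i) //=.
transitivity (((1 - x i * y i) * e i i) * y i * (G + K * G)
  + K * \sum_(j < N | j != i)
      (1 - x i * y i) * (y j * e i j * G + (y i - y j) * e i j * e j i * G)).
  by rewrite -mulr_sumr big_split /= -!mulr_suml; ring.
by rewrite e_geom (eq_bigr _ step) -mulr_sumr; ring.
Qed.

End CauchyProduct.

(** * Coefficients of the generating function: symmetry and Dunkl operators *)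

Section PBasis.

Variable N : nat.
Local Notation P := {mpoly Qkappa[N]}.
Local Notation S := (series N P).
Implicit Types (i j k : 'I_N) (c : Qkappa) (a : 'X_{1..N}) (w : 'S_N).

Let G : S := @pgen N.
Let e i j : S := binser 1 i j.
Let E i j : S := binser kappa i j.

Lemma pgen_prod : @pgen N = \prod_(i < N) (e i i * \prod_(j < N) E i j) :> S.
Proof. by []. Qed.

Lemma binser_msym w c i j :
  smap (msym w) (binser c i j : S) = binser c (w i) j.
Proof.
apply/funext => a; rewrite /smap !binserE; case: (a == _); last exact: msym0.
by rewrite msymZ rmorphXn /= msym_var.
Qed.

Lemma binser_sperm w c i j :
  sperm w (binser c i j : S) = binser c i ((w^-1)%g j).
Proof.
apply/funext => a; rewrite /sperm !binserE mnm_actE; congr (if _ then _ else _).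
apply/eqP/eqP => /mnmP ea; apply/mnmP => k.
  have := ea (w k); rewrite mnm_actE !mulmnE !mnm1E permK => ->.
  by rewrite -(inj_eq (@perm_inj _ w) ((w^-1)%g j)) permKV.
by rewrite mnm_actE ea !mulmnE !mnm1E (inj_eq perm_inj).
Qed.

(** Permuting the x and the y simultaneously only reorders the factors, so permuting the x by w
    amounts to permuting the y by w^-1. *)
Lemma pgen_msym w : smap (msym w) G = sperm w G.
Proof.
rewrite /G pgen_prod smap_prod sperm_prod.
rewrite (reindex_inj (@perm_inj _ (w^-1)%g)); apply: eq_bigr => i _.
rewrite smapM spermM smap_prod sperm_prod binser_msym permKV binser_sperm.
congr (_ * _); rewrite [RHS](reindex_inj (@perm_inj _ w)); apply: eq_bigr => j _.
by rewrite binser_msym permKV binser_sperm permK.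
Qed.

Lemma pbasis_msym w a : msym w (pbasis a) = pbasis (mnm_act w a).
Proof. exact: (congr1 (fun s : S => s a) (pgen_msym w)). Qed.

Lemma smap_mderivM i (s t : S) :
  smap (mderiv i) (s * t) = smap (mderiv i) s * t + s * smap (mderiv i) t.
Proof.
apply/funext => a; rewrite seriesD !seriesM /smap seriesM raddf_sum -big_split /=.
by apply: eq_bigr => b _; rewrite mderivM.
Qed.

Let K : S := mono 0%MM kappa%:MP.
Let x i : S := mono 0%MM 'X_i.
Let y i : S := mono U_(i)%MM 1.

Lemma mono_xy i j : mono U_(j)%MM 'X_i = x i * y j.
Proof. by rewrite monoM add0m mulr1. Qed.

Lemma mono0_1 : mono 0%MM 1 = 1 :> S.
Proof. by apply/funext => a; rewrite series1 /mono; case: eqP. Qed.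

Lemma binser_mderivE c i j k : smap (mderiv i) (binser c k j : S) =
  if k == i then mono 0%MM c%:MP * y j * e k j * (binser c k j : S) else 0.
Proof.
have [->|ki] := eqVneq k i.
  by rewrite binser_mderiv monoM add0m mulr1.
apply/funext => a; rewrite /smap binserE; case: (a == _); last exact: mderiv0.
rewrite mderivZ mpolyXn mderivX mulmnE mnm1E (negPf ki) mul0n.
by rewrite scale0r scaler0.
Qed.

Lemma e_geom i j : (1 - x i * y j) * e i j = 1.
Proof. by rewrite -mono_xy; apply: binser_geom. Qed.

Lemma pgen_mderiv i :
  smap (mderiv i) G = (y i * e i i + K * \sum_(j < N) y j * e i j) * G.
Proof.
apply: cauchy_derivation => [|k j|k j]; first exact: smap_mderivM.
  by rewrite /e binser_mderivE mpolyC1 mono0_1 mul1r.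
exact: binser_mderivE.
Qed.

Lemma pgen_tperm i j : smap (msym (tperm i j)) G =
  \prod_(k < N) (e (tperm i j k) k * \prod_(l < N) E (tperm i j k) l).
Proof.
rewrite /G pgen_prod smap_prod; apply: eq_bigr => k _.
rewrite smapM smap_prod binser_msym; congr (_ * _).
by apply: eq_bigr => l _; rewrite binser_msym.
Qed.

Variable divdiff : 'I_N -> 'I_N -> P -> P.
Hypothesis divdiffP : forall i j (f : P),
  ('X_i - 'X_j) * divdiff i j f = f - msym (tperm i j) f.

Lemma pgen_divdiff i j : i != j ->
  smap (divdiff i j) G = (y i - y j) * e i j * e j i * G.
Proof.
move=> ij.
have Q : mono 0%MM ('X_i - 'X_j) * ((y i - y j) * e i j * e j i * G)
    = G - smap (msym (tperm i j)) G.
  rewrite pgen_tperm (_ : mono 0%MM ('X_i - 'X_j) = x i - x j).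
    exact: (cauchy_divdiff E e_geom ij).
  apply/funext => a; rewrite seriesD seriesN /x /mono.
  by case: (a == _); rewrite ?subr0.
apply/funext => a; have := congr1 (fun s : S => s a) Q.
rewrite mono0_mul seriesD seriesN /smap => Qa.
by apply: (mulfI (mpoly_var_sub_neq0 _ ij)); rewrite divdiffP.
Qed.

Lemma pgen_dunkl i :
  (1 - x i * y i)
      * (smap (mderiv i) G + K * \sum_(j < N | j != i) smap (divdiff i j) G)
    = y i * (G + K * G + K * \sum_(j < N | j != i) smap (msym (tperm i j)) G).
Proof.
have -> : \sum_(j < N | j != i) smap (divdiff i j) G
    = \sum_(j < N | j != i) (y i - y j) * e i j * e j i * G.
  by apply: eq_bigr => j ji; apply: pgen_divdiff; rewrite eq_sym.
rewrite pgen_mderiv (eq_bigr _ (fun j _ => pgen_tperm i j)).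
exact: (cauchy_dunkl K E e_geom i).
Qed.

Local Notation D := (dunkl_of kappa divdiff).

(** The coefficient of y^a in [pgen_dunkl]: the factor y_i shifts the exponent by one and leaves
    nothing when a_i = 0. *)
Lemma pgen_dunkl_coef i a :
  D i (pbasis a) - (if a i != 0%N then 'X_i * D i (pbasis (a - U_(i))%MM) else 0)
    = if a i != 0%N then
        pbasis (a - U_(i))%MM + kappa *: pbasis (a - U_(i))%MM
        + kappa *: \sum_(j < N | j != i) msym (tperm i j) (pbasis (a - U_(i))%MM)
      else 0.
Proof.
have := congr1 (fun s : S => s a) (pgen_dunkl i).
rewrite mulrBl mul1r -mono_xy seriesD seriesN !mono_mul lep1mP mul1r.
by rewrite !seriesD !mono0_mul !series_sum !mul_mpolyC.
Qed.

Lemma pbasis_dunkl0 i a : a i = 0%N -> D i (pbasis a) = 0.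
Proof. by move=> ai; have := pgen_dunkl_coef i a; rewrite ai eqxx subr0. Qed.

Lemma pbasis_dunklS i a : a i != 0%N ->
  D i (pbasis a) = D i ('X_i * pbasis (a - U_(i))%MM)
    + kappa *: pbasis (a - U_(i))%MM.
Proof.
move=> ai; have := pgen_dunkl_coef i a; rewrite ai => /eqP.
rewrite subr_eq (dunkl_mulXi kappa divdiffP) => /eqP ->.
by rewrite [LHS]addrC !addrA addrAC.
Qed.

End PBasis.

(** * Lowering of joint eigenvectors *)

Section EigenSeparation.

Variables (K : fieldType) (V : lmodType K) (I : Type) (T : I -> {linear V -> V}).
Variable W : V -> Prop.
Hypothesis W_lin : forall c u v, W u -> W v -> W (c *: u + v).
Hypothesis W_T : forall i v, W v -> W (T i v).

(** Induction on the number of summands: T_i minus the eigenvalue of the first v_k kills v_k,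
    rescales the other v_j and multiplies v0 by a nonzero constant. *)
Lemma eigen_separation (J : Type) (r : seq J) (Q : pred J) (v : J -> V)
    (lam : J -> I -> K) (v0 : V) (mu : I -> K) :
    (forall i, T i v0 = mu i *: v0) ->
    (forall j i, Q j -> T i (v j) = lam j i *: v j) ->
    (forall j, Q j -> exists i, lam j i != mu i) ->
  W (v0 + \sum_(j <- r | Q j) v j) -> W v0.
Proof.
move=> Tv0 Tv sep; elim: r v v0 Tv0 Tv => [|k r IHr] v v0 Tv0 Tv.
  by rewrite big_nil addr0.
rewrite big_cons; case: ifPn => [Qk|_]; last exact: IHr.
set s := \sum_(j <- r | Q j) v j => Wx; have [i neq] := sep k Qk.
pose c := mu i - lam k i; have c0 : c != 0 by rewrite subr_eq0 eq_sym.
have W0 : W 0 by have := W_lin (-1) Wx Wx; rewrite scaleN1r addNr.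
suff Wc : W (c *: v0).
  by rewrite -[v0]scale1r -(mulVf c0) -scalerA -[_ *: _]addr0; apply: W_lin.
apply: (IHr (fun j => (lam j i - lam k i) *: v j)).
- by move=> l; rewrite linearZ_LR Tv0 !scalerA mulrC.
- by move=> j l Qj; rewrite linearZ_LR /= Tv // !scalerA mulrC.
have := W_lin (- lam k i) Wx (W_T i Wx).
have -> : \sum_(j <- r | Q j) (lam j i - lam k i) *: v j = T i s - lam k i *: s.
  rewrite raddf_sum scaler_sumr -sumrB /=; apply: eq_bigr => j Qj.
  by rewrite scalerBl Tv.
rewrite scaleNr addrC [v0 + _]addrCA !raddfD /= Tv // Tv0.
by rewrite addrACA subrr add0r addrACA -scalerBl.
Qed.

Lemma eigen_component (J : finType) (v : J -> V) (lam : J -> I -> K) (k : J) :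
    (forall j i, T i (v j) = lam j i *: v j) ->
    (forall j, j != k -> exists i, lam j i != lam k i) ->
  W (\sum_j v j) -> W (v k).
Proof.
move=> Tv sep; rewrite (bigD1 k) //=.
exact: (@eigen_separation _ _ (fun j => j != k) v lam _ (lam k)).
Qed.

End EigenSeparation.

(** * The operator theta_m D_m on polynomials killed by D_j for j beyond m *)

Section JackLowering.

Variables (N : nat) (K : fieldType) (kappa : K).
Local Notation P := {mpoly K[N]}.
Variable D : 'I_N -> {linear P -> P}.
Hypothesis D1 : forall i, D i 1 = 0.
Hypothesis D_mulX : forall i k f, k != i ->
  D i ('X_k * f) = 'X_k * D i f - kappa *: msym (tperm i k) f.
Hypothesis D_mulXi : forall i f,
  D i ('X_i * f)
    = 'X_i * D i f + f + kappa *: \sum_(j < N | j != i) msym (tperm i j) f.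
Hypothesis D_msym : forall w i f, msym w (D i f) = D (w i) (msym w f).

Implicit Types (i j k : 'I_N) (f g : P) (w : 'S_N).

Let DD i f g : D i (f + g) = D i f + D i g. Proof. exact: raddfD. Qed.
Let DN i f : D i (- f) = - D i f. Proof. exact: raddfN. Qed.
Let DZ i c f : D i (c *: f) = c *: D i f. Proof. exact: linearZ_LR. Qed.
Let DC := D_comm D1 D_mulX D_mulXi D_msym.

Definition U_of i f : P :=
  D i ('X_i * f) - kappa *: \sum_(j < N | (j < i)%N) msym (tperm j i) f.

Lemma U_is_linear i : linear (U_of i).
Proof.
move=> c f g; rewrite /U_of mulrDr mpoly_scalerAr DD DZ scalerBr addrACA -opprD.
congr (_ - _); rewrite scalerA mulrC -scalerA -scalerDr; congr (_ *: _).
rewrite scaler_sumr -big_split /=; apply: eq_bigr => j _.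
by rewrite msymD msymZ.
Qed.
HB.instance Definition _ i :=
  GRing.isLinear.Build K P P _ (U_of i) (U_is_linear i).

(** The transpositions with j < i in D_i x_i cancel against the subtracted ones. *)
Lemma U_ofE i f : U_of i f =
  'X_i * D i f + f + kappa *: \sum_(j < N | (i < j)%N) msym (tperm i j) f.
Proof.
rewrite /U_of D_mulXi -addrA -scalerBr; congr (_ + _ *: _).
apply/eqP; rewrite subr_eq (bigID (fun j => (i < j)%N)) /=; apply/eqP.
congr (_ + _); apply: eq_big => j; rewrite ?[tperm j i]tpermC // -?leqNgt.
- by rewrite andbC; case: ltngtP => //= ij; rewrite neq_ltn ij orbT.
- by rewrite ltn_neqAle.
Qed.

Lemma msym_tpermC w i j f :
  msym w (msym (tperm i j) f) = msym (tperm (w i) (w j)) (msym w f).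
Proof. by rewrite -!msymMm -tpermJ conjgE mulKVg. Qed.

(* Only the transpositions subtracted in [U_of] depend on the order of the
   indices, so a permutation carries [U_of i] to [U_of (w i)] up to these. *)
Lemma U_of_msym w i f :
  U_of (w i) (msym w f) = msym w
    (D i ('X_i * f) - kappa *: \sum_(j < N | (w j < w i)%N) msym (tperm j i) f).
Proof.
rewrite /U_of msymB msymZ D_msym msymM msym_var (raddf_sum (msym w)) /=.
congr (_ - _ *: _); rewrite (reindex_inj (@perm_inj _ w)) /=.
by apply: eq_bigr => j _; rewrite msym_tpermC.
Qed.

Lemma D_U i m f : i != m ->
  D m (U_of i f) = D i ('X_i * D m f) - kappa *: msym (tperm i m) (D m f)
     - kappa *: \sum_(j < N | (j < i)%N) D m (msym (tperm j i) f).
Proof.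
move=> im; rewrite /U_of DD DN DZ DC (D_mulX _ im) DD DN DZ (raddf_sum (D m)).
congr (_ - _ *: _ - _); rewrite [tperm m i]tpermC.
by rewrite (D_msym (tperm i m) m) tpermR.
Qed.

Variable m : 'I_N.

(* [headed] plays the role of the condition that only exponents b with b_j = 0
   for j > m occur in the p-expansion of f. *)
Definition headed f : Prop :=
  (forall j, (m < j)%N -> D j f = 0) /\
  (forall j k, (m < j)%N -> (m < k)%N -> msym (tperm j k) f = f).

Lemma headed_lin c f g : headed f -> headed g -> headed (c *: f + g).
Proof.
move=> [f0 fs] [g0 gs]; split=> [j mj|j k mj mk].
  by rewrite DD DZ f0 // g0 // scaler0 addr0.
by rewrite msymD msymZ fs // gs.
Qed.

Lemma headed_D f : headed f -> headed (D m f).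
Proof.
move=> [f0 fs]; split=> [j mj|j k mj mk].
  by rewrite DC f0 // raddf0.
by rewrite D_msym tpermD ?fs // -?val_eqE ?gtn_eqF.
Qed.

(** By [U_ofE] only transpositions of positions beyond m remain, and these fix f. *)
Lemma U_headed_gt i f : (m < i)%N -> headed f ->
  U_of i f = (1 + kappa * #|[pred j : 'I_N | (i < j)%N]|%:R) *: f.
Proof.
move=> mi [f0 fs]; rewrite U_ofE f0 // mulr0 add0r (eq_bigr (fun=> f)).
  by rewrite sumr_const scalerDl scale1r -scalerA -scaler_nat.
by move=> j ij; rewrite fs // (ltn_trans mi).
Qed.

Lemma headed_U i f : headed f -> headed (U_of i f).
Proof.
move=> hf; have [mi|im] := ltnP m i.
  rewrite (U_headed_gt mi hf) -[_ *: _]addr0; apply: headed_lin => //.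
  by split=> *; rewrite ?raddf0 ?msym0.
have [f0 fs] := hf; split=> [j mj|j k mj mk].
  have ij : (i < j)%N := leq_ltn_trans im mj.
  rewrite D_U; last by rewrite -val_eqE neq_ltn ij.
  rewrite f0 // mulr0 raddf0 msym0 scaler0 subrr big1 ?scaler0 ?subr0 // => l li.
  have := D_msym (tperm l i) j f; rewrite tpermD ?f0 ?msym0 // -val_eqE neq_ltn ?ij //.
  by rewrite (ltn_trans li ij).
have nt (l : 'I_N) : (l <= i)%N -> tperm j k l = l.
  move=> li; rewrite tpermD // -val_eqE neq_ltn orbC.
    by rewrite (leq_ltn_trans (leq_trans li im) mj).
  by rewrite (leq_ltn_trans (leq_trans li im) mk).
rewrite /U_of msymB msymZ D_msym nt // msymM msym_var nt // fs //.
rewrite (raddf_sum (msym _)) /=; congr (_ - _ *: _); apply: eq_bigr => l li.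
by rewrite msym_tpermC fs // !nt // ltnW.
Qed.

Variable theta : 'S_N.
Hypothesis theta_m : theta m = 0%N :> nat.
Hypothesis theta_lt : forall i, (i < m)%N -> theta i = i.+1 :> nat.
Hypothesis theta_gt : forall i, (m < i)%N -> theta i = i.

Definition lowering f : P := msym theta (D m f).

(** theta keeps the order of the indices other than m and brings m to the front. For i < m this adds
    (i,m) to the subtracted transpositions, the term that D_m creates in passing x_i. For i > m both
    sides carry the same scalar. For i = m no transposition is left, and the shift by 1 comes from
    the summand f in [U_ofE]. *)
Lemma U_lowering i f (l : K) : headed f -> U_of i f = l *: f ->
  U_of (theta i) (lowering f) = (l - (i == m)%:R) *: lowering f.
Proof.
move=> hf Uf; rewrite /lowering U_of_msym -msymZ; congr msym.
have [f0 fs] := hf; case: (ltngtP i m) => [im|mi|/val_inj im].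
- have DU : D m (U_of i f) = l *: D m f by rewrite Uf DZ.
  have mi : m != i by rewrite -val_eqE neq_ltn im orbT.
  rewrite -val_eqE (ltn_eqF im) subr0 -DU D_U 1?eq_sym //.
  rewrite -addrA -opprD -scalerDr; congr (_ - _ *: _).
  rewrite (bigD1 m) /= ?theta_m ?theta_lt // [tperm m i]tpermC; congr (_ + _).
  apply: eq_big => [k|k /andP[ki km]].
    case: (ltngtP k m) => [km|mk|/val_inj->].
    + by rewrite theta_lt // ltnS -val_eqE (ltn_eqF km) andbT.
    + have ik := ltn_trans im mk.
      by rewrite theta_gt // ltnS leqNgt ik /= ltnNge (ltnW ik).
    + by rewrite eqxx andbF (ltnNge m) ltnW.
  by rewrite D_msym tpermD // eq_sym.
- have -> : \sum_(j < N | (theta j < theta i)%N) msym (tperm j i) (D m f)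
      = \sum_(j < N | (j < i)%N) msym (tperm j i) (D m f).
    apply: eq_bigl => k; rewrite (theta_gt mi).
    case: (ltngtP k m) => [km|mk|/val_inj->].
    + by rewrite theta_lt // (leq_ltn_trans km mi) (ltn_trans km mi).
    + by rewrite theta_gt.
    + by rewrite theta_m mi (leq_ltn_trans _ mi).
  rewrite -val_eqE (gtn_eqF mi) subr0 -/(U_of i (D m f)).
  by rewrite (U_headed_gt mi (headed_D hf)) -!DZ -(U_headed_gt mi hf) Uf.
- rewrite im eqxx big_pred0 => [|k]; last by rewrite theta_m.
  (* The sum vanishes because D_m (m,k) f = (m,k) D_k f = 0 for k > m. *)
  have := congr1 (D m) Uf; rewrite im U_ofE !DD !DZ (raddf_sum (D m)) /= big1.
    by rewrite scaler0 subr0 addr0 scalerBl scale1r => <-; rewrite addrK.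
  by move=> k mk; have := D_msym (tperm m k) k f; rewrite tpermR f0 // msym0.
Qed.

Variables (p zeta : 'X_{1..N} -> P) (lam : 'X_{1..N} -> 'I_N -> K).
Hypothesis p_msym : forall w (a : 'X_{1..N}), msym w (p a) = p (mnm_act w a).
Hypothesis p_D0 : forall i (a : 'X_{1..N}), a i = 0%N -> D i (p a) = 0.
Hypothesis p_DS : forall i (a : 'X_{1..N}), a i != 0%N ->
  D i (p a) = D i ('X_i * p (a - U_(i))%MM) + kappa *: p (a - U_(i))%MM.
Hypothesis zeta_U : forall i (a : 'X_{1..N}), U_of i (zeta a) = lam a i *: zeta a.
Hypothesis lam_sep : forall a b : 'X_{1..N}, a != b -> exists i, lam a i != lam b i.
Hypothesis p_zeta : forall a, exists c : 'X_{1..N} -> K, c a = 1 /\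
  p a = \sum_(b : 'X_{1..N < (mdeg a).+1}) c b *: zeta b.

Variable alpha : 'X_{1..N}.
Hypothesis alpha_m : alpha m != 0%N.
Hypothesis alpha_gt : forall j, (m < j)%N -> alpha j = 0%N.
Let beta := mnm_act theta (alpha - U_(m))%MM.
Hypothesis lam_beta : forall i, lam beta (theta i) = lam alpha i - (i == m)%:R.

Lemma headed_p : headed (p alpha).
Proof.
split=> [j mj|j k mj mk]; first exact/p_D0/alpha_gt.
rewrite p_msym; congr p; apply/mnmP => l; rewrite mnmE tpermV.
by case: tpermP => // ->; rewrite !alpha_gt.
Qed.

(** theta m is the first index, so U_(theta m) subtracts no transposition and [p_DS] is simply
    transported by theta. *)
Lemma lowering_p : lowering (p alpha) = U_of (theta m) (p beta) + kappa *: p beta.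
Proof.
rewrite /lowering p_DS // msymD msymZ -p_msym U_of_msym big_pred0 => [|k].
  by rewrite scaler0 subr0.
by rewrite theta_m.
Qed.

(* Expand [p alpha] and [p beta] in the eigenvectors and compare, on both sides
   of [lowering_p], the components that have the spectrum of [zeta beta]. *)
Lemma lowering_zeta :
  lowering (zeta alpha) = (lam beta (theta m) + kappa) *: zeta beta.
Proof.
have [c [ca pa]] := p_zeta alpha; have [d [db pb]] := p_zeta beta.
(* [headed] is a subspace stable under all U_i and the spectra differ, so each component of
   [p alpha] is headed. *)
have cz (b : 'X_{1..N < (mdeg alpha).+1}) : headed (c b *: zeta b).
  apply: (@eigen_component _ _ _ U_of headed headed_lin headed_U _
    (fun b : 'X_{1..N < (mdeg alpha).+1} => c b *: zeta b) (fun b => lam b)).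
  - by move=> j i; rewrite linearZ_LR /= zeta_U !scalerA mulrC.
  - by move=> j jb; apply: lam_sep; rewrite -bmeqP.
  - by rewrite -pa; apply: headed_p.
have cU (b : 'X_{1..N}) i (l : K) : U_of i (l *: zeta b) = lam b i *: (l *: zeta b).
  by rewrite linearZ_LR /= zeta_U !scalerA mulrC.
have zb : headed (zeta alpha).
  by have := cz (BMultinom (ltnSn (mdeg alpha))); rewrite /= ca scale1r.
(* Indexes the unwanted terms of both expansions at once; those of [p beta] carry a minus sign, so
   that they and the wanted difference sum to 0. *)
pose Q (j : 'X_{1..N < (mdeg alpha).+1} + 'X_{1..N < (mdeg beta).+1}) :=
  match j with inl b => b != alpha :> 'X_{1..N} | inr b => b != beta :> 'X_{1..N} end.
pose v (j : 'X_{1..N < (mdeg alpha).+1} + 'X_{1..N < (mdeg beta).+1}) := match j with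
  | inl b => lowering (c b *: zeta b)
  | inr b => - ((lam b (theta m) + kappa) * d b) *: zeta b end.
pose l (j : 'X_{1..N < (mdeg alpha).+1} + 'X_{1..N < (mdeg beta).+1}) i := match j with
  | inl b => lam b ((theta^-1)%g i) - ((theta^-1)%g i == m)%:R
  | inr b => lam b i end.
apply/subr0_eq.
(* Separation for the zero subspace: the part with the spectrum of [zeta beta] must itself
   vanish. *)
apply: (@eigen_separation _ _ _ U_of (fun f => f = 0) _ _ _
  (index_enum _) Q v l _ (lam beta)).
- by move=> e f g -> ->; rewrite scaler0 addr0.
- by move=> i f ->; rewrite raddf0.
- move=> i; rewrite -[i](permKV theta) raddfB /= (U_lowering zb (zeta_U _ _)).
  by rewrite cU scalerBr lam_beta.
- move=> [b|b] i _ /=; last exact: cU.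
  rewrite -[in LHS](permKV theta i); apply: U_lowering; first exact: cz.
  exact: cU.
(* Lowering shifts the spectra of [zeta b] and [zeta alpha] alike, so they remain different. *)
- move=> [b|b] /= nb; last exact: lam_sep.
  have [i li] := lam_sep nb; exists (theta i); rewrite permK lam_beta.
  by apply: contraNneq li => /addIr ->.
have low : lowering (p alpha) = lowering (zeta alpha)
    + \sum_(b : 'X_{1..N < (mdeg alpha).+1} | b != alpha :> 'X_{1..N})
        lowering (c b *: zeta b).
  rewrite pa (bigD1 (BMultinom (ltnSn (mdeg alpha)))) //= ca scale1r.
  by rewrite /lowering raddfD /= msymD (raddf_sum (D m)) (raddf_sum (msym theta)).
have up : U_of (theta m) (p beta) + kappa *: p beta
    = (lam beta (theta m) + kappa) *: zeta beta
    + \sum_(b : 'X_{1..N < (mdeg beta).+1} | b != beta :> 'X_{1..N})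
        ((lam b (theta m) + kappa) * d b) *: zeta b.
  rewrite pb raddf_sum scaler_sumr -big_split /=.
  rewrite (eq_bigr (fun b : 'X_{1..N < (mdeg beta).+1} =>
    ((lam b (theta m) + kappa) * d b) *: zeta b)) => [|b _]; last first.
    by rewrite cU !scalerA -scalerDl -mulrDl.
  by rewrite (bigD1 (BMultinom (ltnSn (mdeg beta)))) //= db mulr1.
rewrite big_sumType /=; move: lowering_p; rewrite low up => lu.
under [X in _ + (_ + X)]eq_bigr do rewrite scaleNr.
by rewrite sumrN addrACA lu -opprD subrr.
Qed.

End JackLowering.

(** * Triangularity *)

Section Triangularity.

Variable N : nat.
Implicit Types (i j : 'I_N) (a b : 'X_{1..N}).

(** Antisymmetry of dominance, for the strictness in [mnm_dom_trans]; entries are recovered from the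
    front as differences of partial sums. *)
Lemma mnm_eq_partial_sums a b :
    (forall j, \sum_(i < N | (i <= j)%N) a i = \sum_(i < N | (i <= j)%N) b i)%N ->
  a = b.
Proof.
move=> ab; apply/mnmP => j; have [l jl] := ubnP (j : nat).
elim: l j jl => // l IHl j; rewrite ltnS => jl.
have := ab j; rewrite (bigD1 j) //= [in RHS](bigD1 j) //=.
rewrite (eq_bigr (fun i => b i)) => [/addIn //|i /andP[ij inj]].
by apply/IHl/(leq_trans _ jl); rewrite ltn_neqAle -val_eqE in inj *; rewrite inj.
Qed.

Lemma mnm_dom_trans : transitive (@mnm_dom N).
Proof.
move=> b a c /andP[ab /forallP leab] /andP[bc /forallP lebc].
apply/andP; split; last first.
  by apply/forallP => j; apply: leq_trans (lebc j) (leab j).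
apply: contra_neq ab => ac; apply: mnm_eq_partial_sums => j.
by apply/eqP; rewrite eqn_leq leab {1}ac lebc.
Qed.

Lemma mnm_tri_irr a : mnm_tri a a = false.
Proof. by rewrite /mnm_tri /mnm_dom !eqxx. Qed.

Lemma mnm_tri_trans : transitive (@mnm_tri N).
Proof.
move=> b a c /andP[/eqP dab tab] /andP[/eqP dbc tbc].
rewrite /mnm_tri dab dbc eqxx /=.
case/orP: tab => [sab|/andP[/eqP sab ab]]; case/orP: tbc => [sbc|/andP[/eqP sbc bc]].
- by rewrite (mnm_dom_trans sab sbc).
- by rewrite -sbc sab.
- by rewrite sab sbc.
- by rewrite sab sbc eqxx (mnm_dom_trans ab bc) orbT.
Qed.

Variables (K : fieldType) (V : lmodType K) (p zeta : 'X_{1..N} -> V).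
Hypothesis zeta_p : forall a, exists A : 'X_{1..N} -> K,
  zeta a = p a + \sum_(b : 'X_{1..N < (mdeg a).+1} | mnm_tri b a) A b *: p b.

Let spanned n (Q : pred 'X_{1..N}) (v : V) := exists c : 'X_{1..N} -> K,
  (forall b, ~~ Q b -> c b = 0) /\ v = \sum_(b : 'X_{1..N < n.+1}) c b *: zeta b.

(** Solves the unitriangular relation for p, by induction on the number of exponents above b. *)
Lemma triangular_inversion a : exists c : 'X_{1..N} -> K, c a = 1 /\
  p a = \sum_(b : 'X_{1..N < (mdeg a).+1}) c b *: zeta b.
Proof.
pose n := mdeg a.
(* The vanishing clause confines the support to b and what lies above it; by transitivity the
   inductive expansions then stay above b. *)
suff claim d b : mdeg b = n -> (#|[pred e : 'X_{1..N < n.+1} | mnm_tri e b]| < d)%N ->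
    exists c, [/\ c b = 1, forall e, e != b -> ~~ mnm_tri e b -> c e = 0 &
      p b = \sum_(e : 'X_{1..N < n.+1}) c e *: zeta e].
  by have [c [ca _ pa]] := claim _ a erefl (ltnSn _); exists c.
elim: d b => // d IHd b bn; rewrite ltnS => card_b.
have spanD (k : K) v w :
    spanned n (fun e => mnm_tri e b) v -> spanned n (fun e => mnm_tri e b) w ->
    spanned n (fun e => mnm_tri e b) (k *: v + w).
  move=> [u [u0 ->]] [t [t0 ->]]; exists (fun e => k * u e + t e); split=> [e eb|].
    by rewrite u0 // t0 // mulr0 addr0.
  rewrite scaler_sumr -big_split /=; apply: eq_bigr => e _.
  by rewrite scalerDl scalerA.
have [A] := zeta_p b; rewrite bn; set v := \sum_(e | _) _ => zb.
have [c [c0 vE]] : spanned n (fun e => mnm_tri e b) v.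
  rewrite /v; elim/big_rec: _ => [|e w eb IH].
    exists (fun=> 0); split=> //; rewrite big1 // => e _; exact: scale0r.
  apply: spanD => //; have en : mdeg e = n by case/andP: eb => /eqP ->.
  have [|u [ue u0 pe]] := IHd e en.
    apply: leq_trans card_b; apply/proper_card/properP; split.
      by apply/subsetP => f; rewrite !inE => /mnm_tri_trans; apply.
    by exists e; rewrite !inE ?eb // mnm_tri_irr.
  exists u; split=> // f fb; apply: u0; first by apply: contraNneq fb => ->.
  by apply: contraNN fb => /mnm_tri_trans; apply.
(* p_b = zeta_b - v, where v is expanded by [c]. *)
exists (fun e => (e == b)%:R - c e); split.
- by rewrite eqxx c0 ?subr0 // mnm_tri_irr.
- by move=> e /negPf -> /c0 ->; rewrite subr0.
have nb : (mdeg b < n.+1)%N by rewrite bn.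
under eq_bigr do rewrite scalerBl.
rewrite sumrB -vE (bigD1 (BMultinom nb)) //= eqxx scale1r big1 ?addr0 ?zb ?addrK //.
by move=> e; rewrite bmeqP /= => /negPf ->; rewrite scale0r.
Qed.

End Triangularity.

(** * Ranks and eigenvalues *)

Fact perm_compA N : associative (@perm_comp N).
Proof. by move=> u v w; rewrite /perm_comp mulgA. Qed.
Fact perm_comp1 N : left_id 1%g (@perm_comp N).
Proof. by move=> u; rewrite /perm_comp mulg1. Qed.
Fact perm_comp1r N : right_id 1%g (@perm_comp N).
Proof. by move=> u; rewrite /perm_comp mul1g. Qed.
HB.instance Definition _ N := Monoid.isLaw.Build 'S_N 1%g (@perm_comp N)
  (@perm_compA N) (@perm_comp1 N) (@perm_comp1r N).

(** * The cycle theta_m and its effect on ranks and eigenvalues *)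

Section Theta.

Variable N : nat.
Implicit Types (i j k : 'I_N) (a : 'X_{1..N}).

Lemma thetaE (m k : 'I_N) :
  theta m k = (if k == m then 0 else if k < m then k.+1 else k)%N :> nat.
Proof.
case: N m k => [[]//|n] m k.
(* Partial products over natural numbers, for induction on their length; [inord] is faithful as the
   indices used are at most n. *)
pose F l : 'S_n.+1 := tperm (inord l.-1) (inord l).
pose T l := \big[@perm_comp n.+1/1%g]_(1 <= j < l.+1) F j.
have -> : theta m = T m.
  rewrite /T (@big_nat_widenl _ _ _ 1 0) // (big_nat_widen _ _ n.+1) //.
  rewrite big_mkord /theta; apply: eq_big => [i|i _]; first by rewrite ltnS.
  congr tperm; last by rewrite inord_val.
  by apply: val_inj; rewrite /= inordK // (leq_ltn_trans (leq_pred i)).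
suff TE l (i : 'I_n.+1) : (l < n.+1)%N ->
    T l i = (if i == l :> nat then 0 else if i < l then i.+1 else i)%N :> nat.
  by rewrite TE.
elim: l i => [|l IHl] i ln.
  by rewrite /T big_geq // perm1; case: eqP.
have ln' := ltnW ln.
(* The right factor of [perm_comp] acts first, so i meets the last transposition before [T l]. *)
rewrite /T big_nat_recr //= -/(T l) permM /F.
case: tpermP => [->|->|].
- by rewrite IHl // !inordK //; do ![case: ifP]; lia.
- by rewrite IHl // !inordK //; do ![case: ifP]; lia.
- move=> /eqP + /eqP; rewrite -!val_eqE /= !inordK //= => il il'.
  by rewrite IHl //; do ![case: ifP]; lia.
Qed.

Lemma mnm_lenP (m : 'I_N) a : mnm_len a = m.+1 ->
  a m != 0%N /\ forall j, (m < j)%N -> a j = 0%N.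
Proof.
move=> len; have le j : a j != 0%N -> (j <= m)%N.
  rewrite -lt0n => aj; rewrite -ltnS -len.
  exact: (leq_bigmax_cond (F := fun j : 'I_N => j.+1)).
split=> [|j mj]; last first.
  by apply/eqP; apply: contraLR mj => /le; rewrite -leqNgt.
apply/eqP => am; suff : (mnm_len a <= m)%N by rewrite len ltnn.
apply/bigmax_leqP => j; rewrite lt0n => aj; rewrite ltn_neqAle le // andbT.
by apply: contraNneq aj => /val_inj ->; rewrite am.
Qed.

Lemma mnm_tilde_theta (m : 'I_N) a i :
  mnm_tilde m a (theta m i) = (a i - (i == m))%N.
Proof. by rewrite mnmE permK mnmBE mnm1E eq_sym. Qed.

Lemma mnm_tildeE (m : 'I_N) a i : (forall j, (m < j)%N -> a j = 0%N) ->
  mnm_tilde m a i = if i == 0%N :> nat then (a m - 1)%N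
    else if (i <= m)%N then a (ord_prev i) else 0%N.
Proof.
move=> a0; rewrite -[i](permKV (theta m)); set k := (_ i); rewrite mnm_tilde_theta.
have := thetaE m k; case: (ltngtP k m) => [km|mk|/val_inj->].
- have kNm : (k == m) = false by rewrite -val_eqE (ltn_eqF km).
  rewrite kNm => tk; rewrite tk /= km subn0; congr (a _).
  by apply: val_inj; rewrite /= tk.
- have kNm : (k == m) = false by rewrite -val_eqE (gtn_eqF mk).
  rewrite kNm => tk; rewrite tk a0 // leqNgt mk.
  by case: eqP => // k0; rewrite k0 in mk.
- by rewrite eqxx => ->.
Qed.

(** The two sets are disjoint, and a single sum of indicators can be reindexed by theta. *)
Lemma rnk_sum a i :
  rnk a i = (\sum_(j < N) ((a i < a j) || (j <= i) && (a j == a i)))%N.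
Proof.
have cardE (Q : pred 'I_N) : #|[set j | Q j]| = (\sum_(j < N) Q j)%N.
  by rewrite -sum1dep_card big_mkcond; apply: eq_bigr => j _; case: (Q j).
rewrite /rnk !cardE -big_split /=; apply: eq_bigr => j _.
by case: ltngtP; rewrite ?andbF ?andbT //=; case: (j <= i)%N.
Qed.

(** Each comparison keeps its outcome. With a_m - 1 at the front, a_j >= a_m becomes a_j > a_m - 1
    for j < m, and a_m > a_i becomes a_m - 1 >= a_i; the tie rule changes accordingly. Entries
    beyond m stay 0 and in place. *)
Lemma rnk_tilde (m : 'I_N) a i : a m != 0%N -> (forall j, (m < j)%N -> a j = 0%N) ->
  rnk (mnm_tilde m a) (theta m i) = rnk a i.
Proof.
move=> am a0; rewrite !rnk_sum (reindex_inj (@perm_inj _ (theta m))) /=.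
apply: eq_bigr => j _; congr nat_of_bool; rewrite !mnm_tilde_theta !thetaE.
have := a0 i; have := a0 j; rewrite -lt0n in am.
have aE (k : 'I_N) : k = m :> nat -> a k = a m by move/val_inj->.
have := aE i; have := aE j; rewrite -!val_eqE /=.
case: (ltngtP i m) => hi; case: (ltngtP j m) => hj Ej Ei A0j A0i /=; lia.
Qed.

Lemma xi_tilde (m : 'I_N) a i : a m != 0%N -> (forall j, (m < j)%N -> a j = 0%N) ->
  xi (mnm_tilde m a) (theta m i) = xi a i - (i == m)%:R.
Proof.
move=> am a0; rewrite /xi rnk_tilde // mnm_tilde_theta.
have [->|_] := eqVneq i m; last by rewrite subn0 subr0.
by rewrite natrB ?lt0n // addrA [LHS]addrAC.
Qed.

(** As a polynomial in kappa, xi_i(a) has constant term a_i + 1; [q] is this polynomial before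
    passing to fractions. *)
Lemma xi_sep a (b : 'X_{1..N}) : a != b -> exists i, xi a i != xi b i.
Proof.
move=> ab; have [i abi] : exists i, a i != b i.
  apply/existsP; apply: contra_neqT ab => /existsPn ab; apply/mnmP => i.
  by apply/eqP; rewrite -[_ == _]negbK ab.
exists i; apply: contra_neq abi.
pose q (c : 'X_{1..N}) : {poly rat} :=
  (N%:R - (rnk c i)%:R) * 'X + (c i)%:R + 1.
have tofrac_nat l : FracField.tofrac (l%:R : {poly rat}) = l%:R :> Qkappa.
  exact: (rmorph_nat (@FracField.tofrac {poly rat})).
have xiE c : xi c i = FracField.tofrac (q c).
  by rewrite /q !tofracD tofracM tofracB !tofrac_nat tofrac1.
have q0 c : (q c)`_0 = (c i).+1%:R.
  rewrite /q !coefD coefM big_ord1 coefX mulr0 add0r coef1 -polyC_natr coefC.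
  by rewrite eqxx natr1.
rewrite !xiE => /eqP; rewrite tofrac_eq => /eqP /(congr1 (fun r : {poly rat} => r`_0)).
by rewrite !q0 => /eqP; rewrite Num.Theory.eqr_nat eqSS => /eqP.
Qed.


End Theta.

Theorem theorem1 (N : nat) (zeta : 'X_{1..N} -> {mpoly Qkappa[N]})
    (zetaP : forall a : 'X_{1..N}, is_pJack a (zeta a))
    (alpha : 'X_{1..N}) (m : 'I_N) (len_alpha : mnm_len alpha = m.+1) :
  dunkl m (zeta alpha)
    = ((N.+1%:R - (rnk alpha m)%:R) * kappa + (alpha m)%:R)
      *: msym (theta m)^-1%g (zeta (mnm_tilde m alpha))
  /\ (forall i : 'I_N,
        mnm_tilde m alpha i
          = if i == 0%N :> nat then (alpha m - 1)%N
            else if (i <= m)%N then alpha (ord_prev i) else 0%N).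
Proof.
have [am a0] := mnm_lenP len_alpha.
split; last by move=> i; apply: mnm_tildeE.
pose dd : 'I_N -> 'I_N -> {mpoly Qkappa[N]} -> {mpoly Qkappa[N]} := @divdiff N.
have ddP i j (f : {mpoly Qkappa[N]}) :
    ('X_i - 'X_j) * dd i j f = f - msym (tperm i j) f.
  exact/esym/eqP/(xchooseP (swap_divides i j f)).
pose D := dunkl_linear kappa ddP.
(* [Uop] unfolds to [U_of kappa D], so the given eigenvalue equations apply as they are. *)
have zeta_U i (a : 'X_{1..N}) : U_of kappa D i (zeta a) = xi a i *: zeta a.
  exact: (proj2 (zetaP a) i).
have inversion := @triangular_inversion N Qkappa _ (@pbasis N) zeta
  (fun a => proj1 (zetaP a)).
have theta_m : theta m m = 0%N :> nat by rewrite thetaE eqxx.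
have theta_lt (i : 'I_N) : (i < m)%N -> theta m i = i.+1 :> nat.
  by move=> im; rewrite thetaE im -val_eqE (ltn_eqF im).
have theta_gt (i : 'I_N) : (m < i)%N -> theta m i = i.
  move=> mi; apply: val_inj; rewrite /= thetaE -val_eqE (gtn_eqF mi).
  by rewrite ltnNge (ltnW mi).
have low := @lowering_zeta N Qkappa kappa D (dunkl1 kappa ddP) (dunkl_mulX kappa ddP)
  (dunkl_mulXi kappa ddP) (dunkl_msym kappa ddP) _ _ theta_m theta_lt theta_gt _ _ _
  (@pbasis_msym N) (pbasis_dunkl0 ddP) (pbasis_dunklS ddP) zeta_U
  (@xi_sep N) inversion alpha am a0 (fun i => xi_tilde i am a0).
have -> : dunkl m (zeta alpha)
    = msym (theta m)^-1%g (lowering D m (theta m) (zeta alpha)).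
  by rewrite /lowering -msymMm mulgV msym1m.
(* The scalar is xi_m(alpha) - 1 + kappa: the 1 cancels the constant in [xi], and kappa turns N into
   N + 1. *)
rewrite low msymZ -/(mnm_tilde m alpha) xi_tilde // eqxx; congr (_ *: _).
by rewrite /xi addrK -natr1; ring.
Qed.
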